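(* There is an absolute constant $C>0$ such that for every Dirichlet character $\chi$ and every real $y \geq 2$, $$ \left| \mathbb{D}(\chi,1;y)^2 - \log \left| \frac{\log y}{L(s_y,\chi)} \right| \right| \le C , $$ where $s_y := 1 + \frac{1}{\log y}$.
   Context: For Dirichlet characters $\chi,\psi$ and real $y$, $\mathbb{D}(\chi,\psi; y) := \left(\sum_{p \leq y} \frac{1 - \operatorname{Re} \chi(p) \overline{\psi}(p)}{p} \right)^{1/2}$, the sum being over primes $p\le y$. In $\mathbb{D}(\chi,1;y)$, the symbol $1$ denotes the trivial character, equal to $1$ at every integer. $L(s,\chi)=\sum_{n\ge 1}\chi(n)n^{-s}$ is the Dirichlet $L$-function (for $\operatorname{Re}(s)>1$). *)

(* Defs.v *)
From HB Require Import structures.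
From mathcomp Require Import all_boot all_order all_algebra.
From mathcomp Require Import all_classical all_reals all_analysis.
From mathcomp Require Import complex.

Set Implicit Arguments.
Unset Strict Implicit.
Unset Printing Implicit Defensive.

Import Order.TTheory GRing.Theory Num.Theory.
Import numFieldNormedType.Exports.

Local Open Scope classical_set_scope.
Local Open Scope ring_scope.
Local Open Scope complex_scope.

(* Characters are taken as functions on all of Z, extended by zero to the
   integers that are not coprime to the modulus q. *)
Definition dirichlet_character (R : realType) (q : nat) (chi : int -> R[i]) :
    Prop :=
  [/\ (0 < q)%N,
      forall m n : int, chi (m * n) = chi m * chi n,
      forall n : int, chi (n + q%:Z) = chi n
    & forall n : int, (chi n != 0) = coprimez n q%:Z].

Definition trivial_character (R : realType) : int -> R[i] := fun=> 1.

Lemma trivial_characterP (R : realType) :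
  dirichlet_character 1 (@trivial_character R).
Proof.
split=> // [m n|n]; first by rewrite /trivial_character mulr1.
by rewrite /trivial_character oner_neq0 coprimezE coprimen1.
Qed.

Definition char_dist (R : realType) (chi psi : int -> R[i]) (y : R) : R :=
  Num.sqrt (\sum_(0 <= p < (Num.truncn y).+1 | prime p)
              (1 - complex.Re (chi p%:Z * (psi p%:Z)^*)) / p%:R).

(* n^s = exp(s log n), meaningful for n >= 1 *)
Definition nat_cpow (R : realType) (n : nat) (s : R[i]) : R[i] :=
  let t := ln (n%:R : R) in
  (expR (complex.Re s * t))%:C *
    (cos (complex.Im s * t) +i* sin (complex.Im s * t)).

(* The Dirichlet series of chi, meaningful for Re(s) > 1.  The limit is taken
   in R[i]^o, that is in R[i] with the topology of the complex modulus. *)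
Definition dirichlet_L (R : realType) (s : R[i]) (chi : int -> R[i]) : R[i] :=
  lim ((fun N : nat =>
          \sum_(1 <= n < N.+1) chi n%:Z * nat_cpow n (- s) : R[i]^o) @ \oo).

(* Main.v *)
(* Put d = 1 / log y and s = 1 + d. The Euler product gives
   log |L(s, chi)| = sum_p Re chi(p) p^(-s) + O(1), for chi as well as for the
   trivial character, where moreover log zeta(s) = log log y + O(1) because
   1 / (2d) <= zeta(s) <= 1 + 1 / d. Subtracting, log |log y / L(s, chi)| is
   sum_p (1 - Re chi(p)) p^(-s) up to O(1), and it remains to replace this by
   sum_(p <= y) (1 - Re chi(p)) / p. Both errors, sum_(p <= y) (1/p - p^(-s))
   and sum_(p > y) p^(-s), are O(1) by the Chebyshev-type bound
   sum_(p <= x) log p / p <= 2 log x, the second one after cutting the primes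
   into the blocks y^k < p <= y^(k+1), on which p^(-s) <= e^(-k) / p.
   The Euler product is obtained by sieving partial sums: removing from
   sum_(n <= N) a(n) the multiples of one prime p after another multiplies the
   limit by 1 - a(p), so convergence of the full series is all that is needed. *)

Require Import Defs.
From HB Require Import structures.
From mathcomp Require Import all_boot all_order all_algebra all_solvable.
From mathcomp Require Import all_classical all_reals all_analysis.
From mathcomp Require Import complex.
From mathcomp Require Import zify ring lra.

Set Implicit Arguments.
Unset Strict Implicit.
Unset Printing Implicit Defensive.

Import Order.TTheory GRing.Theory Num.Theory.
Import numFieldNormedType.Exports.

Local Open Scope ring_scope.
Local Open Scope complex_scope.

(** * Chebyshev-type bounds for sums of [ln p / p] over primes *)

Section PrimeSums.
Context {R : realType}.
Implicit Types (x y d : R) (n m k p : nat).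

Lemma ln_nat_ge0 n : 0 <= ln (n%:R : R).
Proof. by case: n => [|n]; [rewrite ln0 | rewrite ln_ge0 // ler1n]. Qed.

(** In the factorization of [m] every prime divisor [p] occurs with exponent at least 1, so the
    product of the distinct prime divisors is at most [m]; take logarithms. *)
Lemma sum_ln_prime_divisors_le m : (0 < m)%N ->
  \sum_(0 <= p < m.+1 | prime p && (p %| m)%N) ln (p%:R : R) <= ln m%:R.
Proof.
move=> m0.
have H : (\prod_(0 <= p < m.+1 | prime p && (p %| m)) p <= m)%N.
  rewrite -[leqRHS](partnT m0) /partn big_mkcond /=; apply: leq_prod => p _.
  case: ifP => [/andP[pp pm]|_]; last first.
    by case: p => [|p]; [rewrite lognE /= | rewrite expn_gt0].
  by rewrite -{1}[p]expn1 leq_exp2l ?prime_gt1// logn_gt0 mem_primes pp m0.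
rewrite (_ : \sum_(_ <= _ < _ | _) _ =
   ln (\prod_(0 <= p < m.+1 | prime p && (p %| m)%N) p)%:R).
  rewrite ler_ln ?posrE ?ltr0n ?ler_nat //.
  by apply: prodn_cond_gt0 => p /andP[/prime_gt0].
(* Positivity of the partial product is carried along with the identity, because [lnM] asks for it
   at every factor. *)
pose K (u : R) (v : nat) := (0 < v)%N /\ u = ln v%:R.
suff : K (\sum_(0 <= p < m.+1 | prime p && (p %| m)%N) ln (p%:R : R))
  (\prod_(0 <= p < m.+1 | prime p && (p %| m)%N) p)%N by case.
apply: big_rec2 => [|p v u /andP[/prime_gt0 p0 _] [v0 ->]]; first by rewrite /K ln1.
by split; rewrite ?muln_gt0 ?p0// natrM lnM ?posrE ?ltr0n.
Qed.

(** Induction on [n]: passing to [n.+1] raises [n %/ p] by one exactly when [p] divides [n.+1], so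
    the sum grows by at most [ln n.+1]. This is a weak form of Legendre's formula for [ln n!]. *)
Lemma sum_divn_ln_prime_le n :
  \sum_(0 <= p < n.+1 | prime p) (n %/ p)%:R * ln (p%:R : R) <= n%:R * ln n%:R.
Proof.
elim: n => [|n IH]; first by rewrite big_mkcond big_nat1 /= mul0r.
rewrite (_ : \sum_(_ <= _ < _ | _) _ =
    \sum_(0 <= p < n.+1 | prime p) (n %/ p)%:R * ln (p%:R : R) +
    \sum_(0 <= p < n.+2 | prime p && (p %| n.+1)%N) ln (p%:R : R)).
  have h := sum_ln_prime_divisors_le (ltn0Sn n).
  have h2 : n%:R * ln (n%:R : R) <= n%:R * ln n.+1%:R.
    case: n {IH h} => [|n]; first by rewrite !mul0r.
    by rewrite ler_wpM2l// ler_ln ?posrE ?ltr0n// ler_nat.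
  rewrite -[X in _ <= X * _]natr1 mulrDl mul1r.
  by apply: lerD h; exact: le_trans IH h2.
have -> : \sum_(0 <= p < n.+1 | prime p) (n %/ p)%:R * ln (p%:R : R) =
  \sum_(0 <= p < n.+2 | prime p) (n %/ p)%:R * ln (p%:R : R).
  rewrite [RHS]big_mkcond big_nat_recr //= -big_mkcond /= divn_small // mul0r.
  by case: ifP; rewrite addr0.
rewrite [X in _ = _ + X]big_mkcondr /= -big_split /=.
apply: eq_bigr => p pp; rewrite divnS ?prime_gt0// natrD mulrDl addrC.
by case: ifP; rewrite ?mul1r ?mul0r.
Qed.

(* The floor in the previous bound costs a factor 2: [n / p <= 2 * (n %/ p)]
   for [p <= n]. *)
Lemma sum_ln_prime_div_le n :
  \sum_(0 <= p < n.+1 | prime p) ln (p%:R : R) / p%:R <= 2 * ln n%:R.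
Proof.
case: n => [|n]; first by rewrite big_mkcond big_nat1 /= ln0// mulr0.
set m := n.+1.
have m0 : 0 < m%:R :> R by rewrite ltr0n.
rewrite -(ler_pM2l m0) mulr_sumr mulrCA.
apply: (@le_trans _ _ (2 * \sum_(0 <= p < m.+1 | prime p) (m %/ p)%:R * ln (p%:R : R))).
  rewrite mulr_sumr big_nat_cond [leRHS]big_nat_cond.
  apply: ler_sum => p /andP[/andP[_ pm] pp].
  rewrite mulrCA [leRHS]mulrA [leRHS]mulrC ler_wpM2l ?ln_nat_ge0//.
  have p0 := prime_gt0 pp.
  rewrite ler_pdivrMr ?ltr0n// -!natrM ler_nat.
  have := divn_eq m p; have := ltn_pmod m p0.
  have : (0 < m %/ p)%N by rewrite divn_gt0.
  by move: (m %/ p)%N (m %% p)%N => a b; nia.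
by rewrite ler_pM2l// sum_divn_ln_prime_le.
Qed.

(** The range bound [N] only keeps the sum finite; the real cutoff [x] decides which primes count,
    as the blocks up to powers of [y] require. *)
Lemma sum_prime_le_truncn x N (F : nat -> R) : 0 <= x ->
  (forall p, prime p -> 0 <= F p) ->
  \sum_(0 <= p < N | prime p && (p%:R <= x)) F p <=
  \sum_(0 <= p < (Num.truncn x).+1 | prime p) F p.
Proof.
move=> x0 F0; set M := maxn N (Num.truncn x).+1.
rewrite (big_nat_widen _ _ M) ?leq_maxl// [leRHS](big_nat_widen _ _ M) ?leq_maxr//.
rewrite big_mkcond [leRHS]big_mkcond; apply: ler_sum => p _ /=.
rewrite ltnS truncn_ge_nat//.
by case: (boolP (prime p)) => //= pp; do 2!case: ifP => //; rewrite ?F0 ?andbF//; case: (_ <= x).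
Qed.

Lemma sum_ln_prime_div_le_real x N : 1 <= x ->
  \sum_(0 <= p < N | prime p && (p%:R <= x)) ln (p%:R : R) / p%:R <= 2 * ln x.
Proof.
move=> x1; have x0 : 0 <= x by apply: le_trans x1.
apply: le_trans (sum_prime_le_truncn N x0 _) _ => [p _|].
  by rewrite divr_ge0 ?ln_nat_ge0.
apply: le_trans (sum_ln_prime_div_le _) _; rewrite ler_pM2l//.
by rewrite ler_ln ?posrE ?truncn_le// ?(lt_le_trans _ x1)// ltr0n truncn_gt0.
Qed.

End PrimeSums.

(** * Sums of [n^-(1+d)] compared with telescoping differences of [n^-d] *)

Section PowerSums.
Context {R : realType}.
Implicit Types (x y d : R) (n m k p : nat).

Lemma powRN1D x d : 0 < x -> x `^ (- (1 + d)) = x `^ (- d) / x.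
Proof.
move=> x0; rewrite opprD addrC powRD ?(gt_eqF x0) ?implybT//.
by rewrite powR_inv1 ?ltW.
Qed.

Lemma powR_nat_gt0E x d : 0 < x -> x `^ d = expR (d * ln x).
Proof. by move=> x0; rewrite /powR gt_eqF. Qed.

(** This is [ln t <= t - 1] at [t = y / x]; with [x] and [y] exchanged it bounds a logarithm from
    below. *)
Lemma le_ln_sub x y : 0 < x -> 0 < y -> ln y - ln x <= y / x - 1.
Proof.
move=> x0 y0; rewrite -ln_div ?posrE//.
by rewrite -[X in ln X](subrKC 1) le_ln1Dx// ltrBrDl addrN divr_gt0.
Qed.

(** A discrete integral comparison: with [u = ln (n+1) - ln n <= 1/n], one has [(n+1)^-d = n^-d
    e^(-du) >= n^-d (1 - d/n)]. *)
Lemma powR_telescope_le d n : 0 <= d -> (0 < n)%N ->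
  n%:R `^ (- d) - n.+1%:R `^ (- d) <= d * n%:R `^ (- (1 + d)).
Proof.
move=> d0 n0; have n0R : 0 < n%:R :> R by rewrite ltr0n.
have m0R : 0 < n.+1%:R :> R by rewrite ltr0n.
rewrite powRN1D // lerBlDr -lerBlDl !powR_nat_gt0E//.
rewrite [leRHS](_ : _ = expR (- d * ln n%:R) * expR (- d * (ln n.+1%:R - ln n%:R))); last first.
  by rewrite -expRD; congr expR; ring.
have -> (a c : R) : a - d * (a / c) = a * (1 - d / c) by ring.
rewrite ler_wpM2l ?expR_ge0//; apply: le_trans (expR_ge1Dx _).
rewrite lerD2l mulNr lerN2 ler_wpM2l//; apply: le_trans (le_ln_sub n0R m0R) _.
by rewrite -natr1 mulrDl divff ?gt_eqF// mul1r addrAC addrN add0r.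
Qed.

(** The same comparison with [(n+1)^-d] factored out: [n^-d = (n+1)^-d e^(du)], where now
    [u >= 1/(n+1)]. *)
Lemma powR_telescope_ge d n : 0 <= d -> (0 < n)%N ->
  d * n.+1%:R `^ (- (1 + d)) <= n%:R `^ (- d) - n.+1%:R `^ (- d).
Proof.
move=> d0 n0; have n0R : 0 < n%:R :> R by rewrite ltr0n.
have m0R : 0 < n.+1%:R :> R by rewrite ltr0n.
rewrite powRN1D // lerBrDr !powR_nat_gt0E//.
rewrite [leRHS](_ : _ = expR (- d * ln n.+1%:R) * expR (d * (ln n.+1%:R - ln n%:R))); last first.
  by rewrite -expRD; congr expR; ring.
have -> (a c : R) : d * (a / c) + a = a * (1 + d / c) by ring.
rewrite ler_wpM2l ?expR_ge0//; apply: le_trans (expR_ge1Dx _).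
rewrite lerD2l ler_wpM2l// -[leRHS]opprB -[leLHS]opprK lerN2.
apply: le_trans (le_ln_sub m0R n0R) _.
by rewrite -[X in X / _](addrK 1) natr1 mulrBl divff ?gt_eqF// mul1r addrAC addrN add0r.
Qed.

Lemma sum_powR_ge d m : 0 <= d ->
  1 - m.+1%:R `^ (- d) <= d * \sum_(1 <= n < m.+1) n%:R `^ (- (1 + d)).
Proof.
move=> d0; rewrite mulr_sumr.
have := @telescope_sumr R 1 m.+1 (fun n => - (n%:R `^ (- d))) isT.
rewrite powR1 opprK addrC => <-.
rewrite big_nat_cond [leRHS]big_nat_cond; apply: ler_sum => n /andP[/andP[n1 _] _].
by rewrite opprK addrC powR_telescope_le.
Qed.

Lemma sum_powR_tail_le d k m : 0 <= d -> (0 < k)%N ->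
  d * \sum_(k.+1 <= n < m) n%:R `^ (- (1 + d)) <= k%:R `^ (- d).
Proof.
move=> d0 k0; have [mk|km] := leqP m k; first by rewrite big_geq 1?ltnW// mulr0 powR_ge0.
rewrite mulr_sumr; case: m km => // m; rewrite ltnS => km.
rewrite big_add1 /=.
apply: (@le_trans _ _ (k%:R `^ (- d) - m%:R `^ (- d))); last first.
  by rewrite gerBl powR_ge0.
have := @telescope_sumr R k m (fun n => - (n%:R `^ (- d))) km.
rewrite opprK addrC => <-.
rewrite big_nat_cond [leRHS]big_nat_cond; apply: ler_sum => n /andP[/andP[n1 _] _].
by rewrite opprK [leRHS]addrC powR_telescope_ge// (leq_trans k0).
Qed.

End PowerSums.

(** * Cost of replacing [1/p] for [p <= y] by [p^-s] over all primes *)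

Section TruncationAtY.
Context {R : realType}.
Implicit Types (x y d : R) (n m k p : nat).

(** Each term is [(1 - e^(-d ln p)) / p <= d ln p / p] with [d = 1 / ln y], and the prime sum is at
    most [2 ln y]. *)
Lemma sum_prime_small_le y : 2 <= y ->
  \sum_(0 <= p < (Num.truncn y).+1 | prime p)
     ((p%:R : R)^-1 - p%:R `^ (- (1 + 1 / ln y))) <= 2.
Proof.
move=> y2; have y1 : 1 < y by lra.
have ly := ln_gt0 y1; set d := 1 / ln y.
have d0 : 0 < d by rewrite divr_gt0.
apply: (@le_trans _ _ (d * \sum_(0 <= p < (Num.truncn y).+1 | prime p) ln p%:R / p%:R)).
  rewrite mulr_sumr; apply: ler_sum => p /prime_gt0 p0.
  have p0R : 0 < p%:R :> R by rewrite ltr0n.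
  rewrite powRN1D// powR_nat_gt0E// mulrA -{1}[_^-1]mul1r -mulrBl.
  rewrite ler_pM2r ?invr_gt0//; have := expR_ge1Dx (- d * ln p%:R); lra.
apply: (@le_trans _ _ (d * (2 * ln y))); last first.
  by rewrite /d mulrCA div1r mulVf ?mulr1// gt_eqF.
rewrite ler_pM2l//; apply: le_trans (sum_ln_prime_div_le _) _.
rewrite ler_pM2l// ler_ln ?posrE ?truncn_le ?ltr0n ?truncn_gt0//; lra.
Qed.

(** On the block, [p^-d <= e^-k <= 2^-k] and [1 <= ln p / (k ln y)], so [p^-(1+d)] is at most
    [c ln p / p] with [c = 2^-k / (k ln y)]. The bound for primes up to [y^(k+1)] then gives
    [2 ((k+1)/k) 2^-k], and [(k+1)/k <= 2]. *)
Lemma sum_prime_block_le y k N : 1 < y -> (0 < k)%N ->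
  \sum_(0 <= p < N | prime p && (y ^+ k < p%:R <= y ^+ k.+1))
     (p%:R : R) `^ (- (1 + 1 / ln y)) <= 4 * (1 / 2) ^+ k.
Proof.
move=> y1 k0.
have ly := ln_gt0 y1; set d := 1 / ln y.
have d0 : 0 < d by rewrite divr_gt0.
have y0 : 0 < y by lra.
have k0R : 0 < k%:R :> R by rewrite ltr0n.
pose c := (1 / 2) ^+ k / (k%:R * ln y).
have c0 : 0 <= c by rewrite divr_ge0 ?exprn_ge0// mulr_ge0 ?ltW.
apply: (@le_trans _ _ (c * \sum_(0 <= p < N | prime p && (p%:R <= y ^+ k.+1)) ln p%:R / p%:R)).
  rewrite mulr_sumr big_mkcond [leRHS]big_mkcond /=; apply: ler_sum => p _.
  case: (boolP (prime p)) => //= pp; have p0 := prime_gt0 pp.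
  have p0R : 0 < p%:R :> R by rewrite ltr0n.
  case: (boolP (p%:R <= _)) => [_|]; last by rewrite andbF.
  rewrite andbT; case: ifP => [yp|_]; last first.
    by rewrite mulr_ge0// divr_ge0 ?ln_nat_ge0.
  have lp : k%:R * ln y <= ln (p%:R : R).
    by rewrite mulr_natl -lnXn// ler_ln ?posrE ?exprn_gt0// ltW.
  rewrite powRN1D// mulrA ler_pM2r ?invr_gt0// /c.
  rewrite mulrAC ler_pdivlMr ?mulr_gt0//; apply: (ler_pM _ _ _ lp) => //.
    by rewrite mulr_ge0// ltW.
  apply: (@le_trans _ _ (expR (- k%:R))).
    by rewrite powR_nat_gt0E// ler_expR mulNr lerN2 /d div1r mulrC ler_pdivlMr//.
  rewrite -mulrN1 expRM_natl lerXn2r ?nnegrE ?expR_ge0//.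
  rewrite expRN div1r lef_pV2 ?posrE ?expR_gt0//.
  have := expR_ge1Dx (1 : R); lra.
apply: (@le_trans _ _ (c * (2 * ln (y ^+ k.+1)))).
  by rewrite ler_wpM2l// sum_ln_prime_div_le_real// exprn_ege1// ltW.
rewrite lnXn// -[ln y *+ _]mulr_natl /c.
rewrite [leLHS](_ : _ = 2 * (k.+1%:R / k%:R) * (1 / 2) ^+ k); last first.
  by field; rewrite !gt_eqF.
rewrite ler_wpM2r ?exprn_ge0//.
have : k.+1%:R / k%:R <= 2 :> R; last by lra.
rewrite ler_pdivrMr// -natrM ler_nat; lia.
Qed.

Lemma sum_prime_large_le y N : 2 <= y ->
  \sum_((Num.truncn y).+1 <= p < N | prime p) (p%:R : R) `^ (- (1 + 1 / ln y)) <= 4.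
Proof.
move=> y2; have y1 : 1 < y by lra.
have y0 : 0 <= y by lra.
pose F p := (p%:R : R) `^ (- (1 + 1 / ln y)).
(* The blocks [k = 1, ..., K] cover [y < p <= y^(K+1)]; the right side is the geometric sum of
   [4 / 2^k] over them. *)
have blocks K : \sum_(0 <= p < N | prime p && (y < p%:R <= y ^+ K.+1)) F p <=
    4 * (1 - (1 / 2) ^+ K).
  elim: K => [|K IH].
    rewrite big_pred0 ?subrr ?mulr0// => p.
    by rewrite expr1 lt_le_asym andbF.
  apply: (@le_trans _ _ (\sum_(0 <= p < N | prime p && (y < p%:R <= y ^+ K.+1)) F p +
    \sum_(0 <= p < N | prime p && (y ^+ K.+1 < p%:R <= y ^+ K.+2)) F p)).
    rewrite big_mkcond [X in _ <= X + _]big_mkcond [X in _ <= _ + X]big_mkcond.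
    rewrite -big_split /=; apply: ler_sum => p _.
    have Fp : 0 <= F p by exact: powR_ge0.
    case: (prime p) => /=; last by rewrite addr0.
    case: (ltP y p%:R) => yp /=; last first.
      by rewrite add0r; case: ifP.
    by case: (leP p%:R (y ^+ K.+1)) => _ /=; case: ifP; rewrite ?addr0 ?add0r.
  have := lerD IH (@sum_prime_block_le y K.+1 N y1 isT).
  by move/le_trans; apply; rewrite [_ ^+ K.+1]exprS; lra.
have : 4 * (1 - (1 / 2) ^+ N) <= 4 :> R.
  have : 0 <= (1 / 2) ^+ N :> R by rewrite exprn_ge0.
  lra.
apply: le_trans; apply: le_trans (blocks N).
have [NT|TN] := leqP N (Num.truncn y).+1.
  by rewrite big_geq// sumr_ge0// => p _; exact: powR_ge0.
rewrite [leRHS](@big_cat_nat _ _ _ (Num.truncn y).+1)//=; last exact: ltnW.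
rewrite ler_wpDl ?sumr_ge0// => [p _|]; first exact: powR_ge0.
rewrite le_eqVlt; apply/orP; left; apply/eqP; rewrite big_nat_cond [RHS]big_nat_cond.
apply: eq_bigl => p; case: (boolP (_ <= p < _)%N) => //= /andP[p1 p2].
case: (prime p) => //=.
rewrite ltNge -truncn_ge_nat// -ltnNge p1 /=.
(* [N] blocks reach every [p < N], since [p <= 2^N <= y^N]. *)
apply/esym/(@le_trans _ _ (2 ^+ N)).
  by rewrite -natrX ler_nat; apply: leq_trans (ltnW p2) (ltnW (ltn_expl _ _)).
apply: (@le_trans _ _ (y ^+ N)); first by rewrite lerXn2r ?nnegrE.
by rewrite ler_weXn2l// ltW.
Qed.

End TruncationAtY.

(** * Moduli as real numbers, and limits in the complex plane *)

Section ComplexLimits.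
Context {R : realType}.
Local Open Scope classical_set_scope.
Implicit Types (z w : R[i]) (u : nat -> R[i]^o).

(** The norm of [R[i]] takes its values in [R[i]]; this identity moves estimates of moduli to the
    reals. *)
Lemma normcE_Re z : `|z| = (complex.Re `|z|)%:C.
Proof. by rewrite normc_def. Qed.

Lemma le_normc_Re z : `|complex.Re z| <= complex.Re `|z|.
Proof. by rewrite -lecR -normcE_Re normc_ge_Re. Qed.

Lemma sqr_normc_Re z : complex.Re `|z| ^+ 2 = complex.Re z ^+ 2 + complex.Im z ^+ 2.
Proof. by rewrite normc_def /= sqr_sqrtr// addr_ge0// sqr_ge0. Qed.

Lemma normc_Re_ge0 z : 0 <= complex.Re `|z|.
Proof. exact: le_trans (normr_ge0 _) (le_normc_Re z). Qed.

Lemma le_normc_Im z : `|complex.Im z| <= complex.Re `|z|.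
Proof.
rewrite -(@ler_pXn2r _ 2) ?nnegrE ?normc_Re_ge0// real_normK ?num_real//.
by rewrite sqr_normc_Re lerDr sqr_ge0.
Qed.

Lemma normc_le_ReD z : complex.Re `|z| <= `|complex.Re z| + `|complex.Im z|.
Proof.
rewrite -(@ler_pXn2r _ 2) ?nnegrE ?normc_Re_ge0 ?addr_ge0//.
rewrite sqr_normc_Re sqrrD !real_normK ?num_real//.
by rewrite -addrA [_ *+ 2 + _]addrC addrA lerDl mulrn_wge0 ?mulr_ge0.
Qed.

Lemma normc_ReM z w : complex.Re `|z * w| = complex.Re `|z| * complex.Re `|w|.
Proof. by rewrite normrM [in LHS](normcE_Re z) [in LHS](normcE_Re w) -rmorphM. Qed.

Lemma normc_ReV z : complex.Re `|z^-1| = (complex.Re `|z|)^-1.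
Proof.
have [->|z0] := eqVneq z 0; first by rewrite invr0 normr0 /= invr0.
have n0 : complex.Re `|z| != 0.
  by apply: contra z0 => /eqP h; rewrite -normr_eq0 normcE_Re h.
by apply: (mulfI n0); rewrite -normc_ReM !divff// normr1.
Qed.

Lemma normc_real (x : R) : complex.Re `|x%:C| = `|x|.
Proof. by rewrite normc_def /= expr0n addr0 sqrtr_sqr. Qed.

Lemma normc_realB (x y : R) : complex.Re `|x%:C - y%:C| = `|x - y|.
Proof. by rewrite normc_def /= subrr expr0n addr0 sqrtr_sqr. Qed.

Lemma cvgc_Re_Im u (x y : R) :
  (fun n => complex.Re (u n)) @ \oo --> x ->
  (fun n => complex.Im (u n)) @ \oo --> y -> u @ \oo --> (x +i* y : R[i]^o).
Proof.
move=> /cvgrPdist_lt ux /cvgrPdist_lt uy; apply/cvgrPdist_lt => e.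
(* The tolerance [e] is complex: being positive it has zero imaginary part, and its real part is
   split into halves. *)
rewrite ltcE /= => /andP[/eqP e0 e1].
have e2 : 0 < complex.Re e / 2 by rewrite divr_gt0.
near=> n.
rewrite normcE_Re ltcE /= e0 eqxx /=.
apply: le_lt_trans (normc_le_ReD _) _; rewrite (splitr (complex.Re e)).
have -> : complex.Re ((x +i* y : R[i]) - u n) = x - complex.Re (u n) by case: (u n).
have -> : complex.Im ((x +i* y : R[i]) - u n) = y - complex.Im (u n) by case: (u n).
by apply: ltrD; near: n; [exact: ux | exact: uy].
Unshelve. all: by end_near. Qed.

(** Closed discs are closed. This carries bounds from partial sums to limits, around 1 for sieved
    sums and around the midpoint of an interval for zeta. *)
Lemma cvgc_norm_le u (l w : R[i]) (c : R) : u @ \oo --> (l : R[i]^o) ->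
  (\forall n \near \oo, complex.Re `|u n - w| <= c) -> complex.Re `|l - w| <= c.
Proof.
move=> /cvgrPdist_lt ul uw; apply/ler_addgt0Pr => e e0.
have e1 : 0 < e%:C :> R[i] by rewrite ltcR.
have [n [h1 h2]] : exists n, complex.Re `|u n - w| <= c /\ `|l - u n| < e%:C.
  have : \forall n \near \oo, complex.Re `|u n - w| <= c /\ `|l - u n| < e%:C.
    by near=> n; split; near: n => //; exact: ul.
  by case=> N _ /(_ N (leqnn N)) ?; exists N.
rewrite -lecR rmorphD /= -normcE_Re.
apply: le_trans (ler_distD (u n) _ _) _; rewrite [leRHS]addrC lerD ?(ltW h2)//.
by rewrite normcE_Re lecR.
Unshelve. all: by end_near. Qed.

Lemma is_cvg_series_dominated (u v : R^nat) :
  (forall n, `|u n| <= v n) -> cvgn (series v) -> cvgn (series u).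
Proof.
move=> uv cv; apply: normed_cvg; apply: (series_le_cvg _ _ uv cv) => n //=.
exact: le_trans (normr_ge0 _) (uv n).
Qed.

(** One sieve step in the limit: [N %/ p] tends to infinity with [N], so the dilated sequence keeps
    the limit [l]. *)
Lemma cvg_sub_dilate (K : numFieldType) (u : nat -> K) (l c : K) p : (0 < p)%N ->
  u @ \oo --> l -> (fun N => u N - c * u (N %/ p)%N) @ \oo --> l - c * l.
Proof.
move=> p0 ul.
have h : (u \o (fun N => N %/ p)%N) @ \oo --> l.
  by apply: cvg_comp ul; exact: cvg_divnr.
by apply: cvgB => //; exact: cvgMl_tmp.
Qed.

End ComplexLimits.

(** * The Euler product by sieving partial sums *)

Section EulerProduct.
Context {R : realType}.
Local Open Scope classical_set_scope.
Implicit Types (a : nat -> R[i]) (d : R) (k m n p N : nat).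

Definition rough k n := all (fun p => prime p ==> ~~ (p %| n)%N) (iota 0 k).

Lemma roughS k n : rough k.+1 n = rough k n && (prime k ==> ~~ (k %| n)%N).
Proof. by rewrite /rough -addn1 iotaD all_cat /= add0n andbT. Qed.

Lemma rough1 k : rough k 1.
Proof.
apply/allP => p _; apply/implyP => pp; rewrite dvdn1.
by apply: contraL pp => /eqP ->.
Qed.

(** If [n < k], the least prime factor of [n] would be a forbidden prime below [k]. *)
Lemma rough_ge k n : (1 < n)%N -> rough k n -> (k <= n)%N.
Proof.
move=> n1 /allP h; rewrite leqNgt; apply/negP => nk.
have pk : (pdiv n < k)%N by apply: leq_ltn_trans nk; apply: pdiv_leq; exact: ltnW.
have := h (pdiv n); rewrite mem_iota /= add0n => /(_ pk).
by rewrite pdiv_prime// pdiv_dvd.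
Qed.

Lemma rough_mul p n : prime p -> rough p (p * n) = rough p n.
Proof.
move=> pp; apply: eq_in_all => r; rewrite mem_iota add0n /= => rp.
case: (boolP (prime r)) => //= pr.
by rewrite Euclid_dvdM// dvdn_prime2// (ltn_eqF rp).
Qed.

Definition cmultiplicative a :=
  a 1%N = 1 /\ forall m n, (0 < m)%N -> (0 < n)%N -> a (m * n)%N = a m * a n.

(** At [k = 0] no prime is sieved out, so [rough_sum a 0] is the plain partial sum. *)
Definition rough_sum a k N : R[i] := \sum_(1 <= n < N.+1 | rough k n) a n.

(** The multiples counted are [p * n] with [n <= N %/ p], and the factor [p] does not affect
    divisibility by smaller primes. In the induction, [N %/ p] grows exactly when [p] divides the
    new index. *)
Lemma rough_sum_dvd a p N : cmultiplicative a -> prime p ->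
  \sum_(1 <= n < N.+1 | rough p n && (p %| n)%N) a n = a p * rough_sum a p (N %/ p).
Proof.
move=> [_ aM] pp; have p0 := prime_gt0 pp; rewrite /rough_sum.
elim: N => [|N IH]; first by rewrite div0n !big_geq// mulr0.
rewrite big_mkcond big_nat_recr//= -big_mkcond /= IH divnS//.
have [pN|pN] := boolP (p %| N.+1)%N; last by rewrite andbF addr0 add0n.
rewrite andbT add1n [in RHS]big_mkcond big_nat_recr//= -big_mkcond /= mulrDr; congr (_ + _).
have E : N.+1 = (p * (N %/ p).+1)%N.
  by rewrite -[LHS](divnK pN) mulnC divnS// pN.
by rewrite {1 2}E rough_mul//; case: ifP => _; rewrite ?mulr0// aM.
Qed.

Lemma rough_sumS a k N : cmultiplicative a ->
  rough_sum a k.+1 N =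
  if prime k then rough_sum a k N - a k * rough_sum a k (N %/ k) else rough_sum a k N.
Proof.
move=> am; rewrite /rough_sum; case: ifP => pk; last first.
  by apply: eq_bigl => n; rewrite roughS pk andbT.
rewrite -/(rough_sum a k (N %/ k)) -rough_sum_dvd//.
rewrite [X in _ = X - _](bigID (fun n => k %| n)%N) /= addrAC subrr add0r.
by apply: eq_bigl => n; rewrite roughS pk.
Qed.

(** At a prime [k] the sieve subtracts [a k] times the rough sum at [N %/ k], so the limit gains the
    factor [1 - a k]; at other [k] nothing changes. *)
Lemma cvg_rough_sum a (l : R[i]) k : cmultiplicative a ->
  (rough_sum a 0 : nat -> R[i]^o) @ \oo --> (l : R[i]^o) ->
  (rough_sum a k : nat -> R[i]^o) @ \oo -->
    (l * \prod_(0 <= p < k | prime p) (1 - a p) : R[i]^o).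
Proof.
move=> am al; elim: k => [|k IH].
  rewrite (big_geq (leqnn 0)) mulr1.
  exact: al.
have -> : \prod_(0 <= p < k.+1 | prime p) (1 - a p) =
    \prod_(0 <= p < k | prime p) (1 - a p) * (if prime k then 1 - a k else 1).
  by rewrite big_mkcond big_nat_recr//= -big_mkcond.
rewrite (_ : rough_sum a k.+1 = fun N => if prime k then
  rough_sum a k N - a k * rough_sum a k (N %/ k) else rough_sum a k N); last first.
  by apply/funext => N; exact: rough_sumS.
case: ifP => pk; last by rewrite mulr1.
set q := \prod_(_ <= _ < _ | _) _ in IH *.
rewrite (_ : l * (q * (1 - a k)) = l * q - a k * (l * q)); last by ring.
exact: (cvg_sub_dilate (prime_gt0 pk) IH).
Qed.

(** Apart from [n = 1], which cancels, every surviving index exceeds [k], so the difference is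
    dominated by a tail of the sum of [n^-(1+d)]. *)
Lemma rough_sum_sub1_le a d k N : 0 < d -> (0 < k)%N -> (0 < N)%N -> a 1%N = 1 ->
  (forall n, (0 < n)%N -> complex.Re `|a n| <= n%:R `^ (- (1 + d))) ->
  complex.Re `|rough_sum a k.+1 N - 1| <= k%:R `^ (- d) / d.
Proof.
move=> d0 k0 N0 a1 ale.
rewrite /rough_sum big_mkcond big_ltn// rough1 a1 addrAC subrr add0r.
rewrite ler_pdivlMr// mulrC.
apply: le_trans (sum_powR_tail_le (maxn N.+1 k.+1) (ltW d0) k0); rewrite ler_pM2l//.
rewrite -lecR -normcE_Re (le_trans (ler_norm_sum _ _ _))// rmorph_sum /=.
have [Nk|kN] := leqP N.+1 k.+1.
  rewrite [leRHS]big_geq// big_nat_cond big1// => n /andP[/andP[n1 nN] _].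
  case: ifP => [/rough_ge|]; last by rewrite normr0.
  by move=> /(_ n1) kn; have := leq_ltn_trans kn (leq_trans nN Nk); rewrite ltnn.
rewrite (big_cat_nat _ (n := k.+1))//=; last exact: ltnW.
rewrite [X in X + _]big_nat_cond [X in X + _]big1 ?add0r => [|n /andP[/andP[n1 nk] _]].
  rewrite big_nat_cond [leRHS]big_nat_cond; apply: ler_sum => n /andP[/andP[n1 _] _].
  case: ifP => _; last by rewrite normr0 ler0c.
  by rewrite normcE_Re lecR ale// (leq_trans _ n1).
case: ifP => [/rough_ge|]; last by rewrite normr0.
by move=> /(_ n1); rewrite leqNgt nk.
Qed.

End EulerProduct.

(** * The logarithm of the Euler product, up to a bounded error *)

Section LogEulerProduct.
Context {R : realType}.
Local Open Scope classical_set_scope.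
Local Notation cabs z := (complex.Re `|z|).
Implicit Types (x y h d c : R) (a : nat -> R[i]) (z l : R[i]) (k n p : nat).

(** From below, [ln (1 + h) >= h / (1 + h)]; this is at least [h - 4 h^2] because
    [h^2 (4 h + 3) >= 0], whence the threshold [-3/4]. *)
Lemma ln1D_quadratic h : - (3 / 4) <= h -> h - 4 * h ^+ 2 <= ln (1 + h) <= h.
Proof.
move=> h34; have h0 : 0 < 1 + h by lra.
rewrite le_ln1Dx ?andbT; last by lra.
have := le_ln_sub h0 ltr01; rewrite ln1 sub0r => le1.
rewrite -[leRHS]opprK lerNr (le_trans le1)// lerBlDr ler_pdivrMr//.
have : 0 <= h ^+ 2 * (h + 3 / 4) by rewrite mulr_ge0 ?sqr_ge0//; lra.
by rewrite !expr2; lra.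
Qed.

(** Write [|1 - z|^2 = 1 + h] with [h = |z|^2 - 2 Re z]. Then [h >= |z|^2 - 2|z| >= -3/4] and
    [|h| <= (5/2) |z|], so [2 ln |1 - z|] lies between [h - 25 |z|^2] and [h]. *)
Lemma ln_normc_1sub z : cabs z <= 1 / 2 ->
  0 < cabs (1 - z) /\ `|ln (cabs (1 - z)) + complex.Re z| <= 13 * cabs z ^+ 2.
Proof.
move=> z2; have z0 := normc_Re_ge0 z; have := le_normc_Re z.
have := sqr_normc_Re (1 - z); have := sqr_normc_Re z.
have := normc_Re_ge0 (1 - z).
case: z z2 z0 => u v; rewrite [complex.Re (1 - _)]/= [complex.Im (1 - _)]/=.
rewrite [complex.Re (_ +i* _)]/= [complex.Im (_ +i* _)]/=.
set r := cabs _; set s := cabs _ => r2 r0 s0 rE sE ur.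
have /andP[ur1 ur2] : - r <= u <= r by rewrite -ler_norml.
pose h := r ^+ 2 - 2 * u.
have sE' : s ^+ 2 = 1 + h by rewrite sE /h rE; ring.
have h34 : - (3 / 4) <= h by rewrite /h expr2; nra.
have sgt0 : 0 < s.
  rewrite lt_neqAle s0 andbT eq_sym -sqrf_eq0 sE' gt_eqF//; lra.
split=> //.
have /andP[l1 l2] := ln1D_quadratic h34.
have hh : h ^+ 2 <= 25 / 4 * r ^+ 2.
  have h1 : - (5 / 2 * r) <= h by rewrite /h expr2; nra.
  have h2 : h <= 5 / 2 * r by rewrite /h expr2; nra.
  by rewrite !expr2; nra.
have lE : ln s *+ 2 = ln (1 + h) by rewrite -lnXn// sE'.
have hE : h = r ^+ 2 - 2 * u by [].
have := sqr_ge0 r; rewrite mulr2n in lE; rewrite ler_norml.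
move: (h ^+ 2) (r ^+ 2) (ln s) (ln (1 + h)) hE lE l1 l2 hh.
by clearbody h; move=> X Y Z W; intros; apply/andP; split; lra.
Qed.

Lemma ln_normc_prod (P : pred nat) (F : nat -> R[i]) (s : seq nat) :
  (forall p, P p -> 0 < cabs (F p)) ->
  0 < cabs (\prod_(p <- s | P p) F p) /\
  ln (cabs (\prod_(p <- s | P p) F p)) = \sum_(p <- s | P p) ln (cabs (F p)).
Proof.
move=> F0.
pose K z x := 0 < cabs z /\ ln (cabs z) = x.
apply: (big_rec2 K) => [|p z x Pp [z0 zx]]; first by rewrite /K normr1 /= ln1.
have Fp := F0 _ Pp.
by rewrite /K normc_ReM mulr_gt0// lnM ?posrE// zx.
Qed.

Lemma powR_nat_small d c : 0 < d -> 0 < c ->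
  exists K, forall k, (K <= k)%N -> (0 < k)%N /\ k%:R `^ (- d) <= c.
Proof.
(* The threshold is [c^(-1/d)]; the successor also forces [k] to be positive. *)
move=> d0 c0; pose x := expR (- ln c / d); exists (Num.truncn x).+1 => k kK.
have k0 : (0 < k)%N by exact: leq_trans kK.
have kR : 0 < k%:R :> R by rewrite ltr0n.
split=> //; rewrite powR_nat_gt0E// -[leRHS]lnK ?posrE// ler_expR mulNr lerNl.
rewrite mulrC -ler_pdivrMr// -[leLHS](expRK) ler_ln ?posrE ?expR_gt0//.
by apply: ltW; apply: lt_le_trans (truncnS_gt _) _; rewrite ler_nat.
Qed.

(** Primes are among the integers [n >= 2], and the sum of [n^-2] over these is the tail bound at
    [d = 1], [k = 1]. *)
Lemma sum_prime_sqr_le k : \sum_(0 <= p < k | prime p) (p%:R : R)^-1 ^+ 2 <= 1.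
Proof.
have := @sum_powR_tail_le R 1 1 (maxn k 2) ler01 isT; rewrite mul1r powR1.
apply: le_trans.
have -> : \sum_(0 <= p < k | prime p) (p%:R : R)^-1 ^+ 2 =
          \sum_(2 <= p < maxn k 2 | prime p && (p < k)%N) (p%:R : R)^-1 ^+ 2.
  rewrite (big_nat_widen _ _ (maxn k 2)) ?leq_maxl//.
  rewrite (big_cat_nat (n := 2)) ?leq_maxr//= [X in X + _]big_mkcond.
  by rewrite !big_nat_recr//= big_geq//= !add0r.
rewrite big_mkcond big_nat_cond [leRHS]big_nat_cond /=; apply: ler_sum => p /andP[/andP[p2 _] _].
case: ifP => // _; have p0 : 0 < p%:R :> R by rewrite ltr0n (leq_trans _ p2).
by rewrite powRN1D// powR_inv1 ?ler0n// expr2.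
Qed.

Lemma powRN1D_le_inv d n : 0 <= d -> (0 < n)%N -> (n%:R : R) `^ (- (1 + d)) <= n%:R^-1.
Proof.
move=> d0 n0; have n0R : 0 < n%:R :> R by rewrite ltr0n.
rewrite powRN1D// ler_piMl ?invr_ge0 ?ler0n// powR_nat_gt0E//.
by rewrite expR_le1 mulNr oppr_le0 mulr_ge0// ln_nat_ge0.
Qed.

(** Finite prime sums beyond a threshold allow two characters to be compared at a common [k]. For
    large [k] the product of [l] with all [1 - a p] is within 1/2 of 1, so its log modulus is at
    most 1 in size; the second-order errors of [ln |1 - a p|] add at most 13. *)
Lemma ln_normc_Euler_product a d l : 0 < d -> cmultiplicative a ->
  (forall n, (0 < n)%N -> cabs (a n) <= n%:R `^ (- (1 + d))) ->
  (rough_sum a 0 : nat -> R[i]^o) @ \oo --> (l : R[i]^o) ->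
  0 < cabs l /\ exists K, forall k, (K <= k)%N ->
    `|ln (cabs l) - \sum_(0 <= p < k | prime p) complex.Re (a p)| <= 14.
Proof.
move=> d0 am ale al.
(* The value [d / 2] makes the sieve error [k^-d / d] at most 1/2. *)
have [|K hK] := @powR_nat_small d (d / 2) d0; first by rewrite divr_gt0.
have ap p : prime p -> cabs (a p) <= p%:R^-1.
  move=> /prime_gt0 p0; apply: le_trans (ale _ p0) _.
  by apply: powRN1D_le_inv => //; exact: ltW.
have ap2 p : prime p -> cabs (a p) <= 1 / 2.
  move=> pp; apply: le_trans (ap _ pp) _; rewrite div1r lef_pV2 ?posrE ?ltr0n ?prime_gt0//.
  by rewrite ler_nat prime_gt1.
have F0 p : prime p -> 0 < cabs (1 - a p) by move=> /ap2 /ln_normc_1sub [].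
have near1 k : (K < k)%N ->
    cabs (l * \prod_(0 <= p < k | prime p) (1 - a p) - 1) <= 1 / 2.
  case: k => // k; rewrite ltnS => /hK [k0 kd].
  apply: (cvgc_norm_le (cvg_rough_sum am al)).
  exists 1%N => // N /= N0.
  apply: le_trans (rough_sum_sub1_le d0 k0 N0 (proj1 am) ale) _.
  by rewrite ler_pdivrMr// (le_trans kd)//; lra.
have norm_near1 z : cabs (z - 1) <= 1 / 2 -> 1 / 2 <= cabs z <= 3 / 2.
  move=> z1; have n1 : cabs 1 = 1 :> R by rewrite normr1.
  have := ler_normD (z - 1) 1; rewrite subrK normcE_Re [`|z - 1|]normcE_Re.
  rewrite [`|1|]normcE_Re -rmorphD lecR n1 => h1.
  have := ler_distD z (1 : R[i]) 0; rewrite !subr0 [`|1 - z|]distrC.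
  rewrite [`|z|]normcE_Re [`|z - 1|]normcE_Re [`|1|]normcE_Re -rmorphD lecR n1 => h2.
  by apply/andP; split; lra.
(* If [l] vanished, the product within 1/2 of 1 would be 0. *)
have l0 : 0 < cabs l.
  rewrite lt_neqAle normc_Re_ge0 andbT eq_sym; apply/eqP => l0.
  have /andP[+ _] := norm_near1 _ (near1 K.+1 (ltnSn _)).
  by rewrite normc_ReM l0 mul0r; lra.
split=> //; exists K.+1 => k kK.
have /andP[b1 b2] := norm_near1 _ (near1 k kK).
have [q0 lnq] := @ln_normc_prod prime (fun p => 1 - a p) (index_iota 0 k) F0.
move: b1 b2; rewrite normc_ReM.
set Q := \prod_(_ <- _ | _) _ in q0 lnq *; rewrite -/Q => b1 b2.
have lnlQ : ln (cabs l * cabs Q) = ln (cabs l) + ln (cabs Q) by rewrite lnM ?posrE.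
have g0 : 0 < cabs l * cabs Q by rewrite mulr_gt0.
have u1 : ln (cabs l * cabs Q) <= 1.
  by have := le_ln_sub ltr01 g0; rewrite ln1 divr1; lra.
have u2 : -1 <= ln (cabs l * cabs Q).
  have := le_ln_sub g0 ltr01; rewrite ln1 sub0r.
  have : 1 / (cabs l * cabs Q) <= 2 by rewrite ler_pdivrMr//; lra.
  by lra.
have err : `|\sum_(0 <= p < k | prime p) ln (cabs (1 - a p)) +
             \sum_(0 <= p < k | prime p) complex.Re (a p)| <= 13.
  rewrite -big_split /=; apply: le_trans (ler_norm_sum _ _ _) _.
  apply: (@le_trans _ _ (13 * \sum_(0 <= p < k | prime p) (p%:R : R)^-1 ^+ 2)).
    rewrite mulr_sumr; apply: ler_sum => p pp.
    have [_ /le_trans] := ln_normc_1sub (ap2 p pp); apply.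
    rewrite ler_pM2l// lerXn2r ?nnegrE ?normc_Re_ge0 ?invr_ge0//; exact: ap.
  by have := sum_prime_sqr_le k; lra.
move: err; rewrite -lnq !ler_norml => /andP[e1 e2].
by apply/andP; split; lra.
Qed.

Lemma sum_powR_le d m : 0 < d ->
  \sum_(1 <= n < m.+1) (n%:R : R) `^ (- (1 + d)) <= 1 + 1 / d.
Proof.
move=> d0; case: m => [|m]; first by rewrite big_geq// addr_ge0// divr_ge0// ltW.
rewrite big_ltn// powR1 lerD2l ler_pdivlMr// mulrC.
by have := @sum_powR_tail_le R d 1 m.+2 (ltW d0) isT; rewrite powR1.
Qed.

(** The real and imaginary parts are both dominated by the series of [n^-(1+d)], whose partial sums
    are monotone and bounded. *)
Lemma is_cvg_rough_sum0 a d : 0 < d ->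
  (forall n, (0 < n)%N -> cabs (a n) <= n%:R `^ (- (1 + d))) ->
  exists l, (rough_sum a 0 : nat -> R[i]^o) @ \oo --> (l : R[i]^o).
Proof.
move=> d0 ale; pose v n := (n.+1%:R : R) `^ (- (1 + d)).
have cv : cvgn (series v).
  apply: nondecreasing_is_cvgn.
    by apply/nondecreasing_seqP => n; rewrite /series /= big_nat_recr//= lerDl powR_ge0.
  exists (1 + 1 / d) => _ [n _ <-].
  by apply: le_trans (sum_powR_le n d0); rewrite big_add1.
have ReD : {morph (@complex.Re R) : z w / z + w >-> z + w} by case=> ? ? [].
have ImD : {morph (@complex.Im R) : z w / z + w >-> z + w} by case=> ? ? [].
have seriesE : rough_sum a 0 = series (fun n => a n.+1 : R[i]^o).
  by apply/funext => N; rewrite /rough_sum /series /= big_add1.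
have cRe : cvgn (series (fun n => complex.Re (a n.+1))).
  by apply: is_cvg_series_dominated cv => n; apply: le_trans (le_normc_Re _) (ale _ _).
have cIm : cvgn (series (fun n => complex.Im (a n.+1))).
  by apply: is_cvg_series_dominated cv => n; apply: le_trans (le_normc_Im _) (ale _ _).
exists (lim (series (fun n => complex.Re (a n.+1)) @ \oo) +i*
        lim (series (fun n => complex.Im (a n.+1)) @ \oo)).
apply: cvgc_Re_Im; rewrite seriesE.
  rewrite (_ : (fun _ => _) = series (fun n => complex.Re (a n.+1)))//.
  by apply/funext => N; rewrite /series /= (big_morph _ ReD (erefl _)).
rewrite (_ : (fun _ => _) = series (fun n => complex.Im (a n.+1)))//.
by apply/funext => N; rewrite /series /= (big_morph _ ImD (erefl _)).
Qed.

End LogEulerProduct.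

(** * Dirichlet characters, their series, and the comparison with zeta *)

Section Characters.
Context {R : realType}.
Local Open Scope classical_set_scope.
Local Notation cabs z := (complex.Re `|z|).
Implicit Types (chi : int -> R[i]) (d y : R) (q n k : nat).

Lemma dirichlet_character1 q chi : dirichlet_character q chi -> chi 1 = 1.
Proof.
case=> _ chiM _ chi0; have : chi 1 * (chi 1 - 1) = 0.
  by rewrite mulrBr -chiM !mulr1 subrr.
move/eqP; rewrite mulf_eq0 subr_eq0 => /orP[/eqP c0|/eqP//].
by have := chi0 1; rewrite c0 eqxx coprimezE coprime1n.
Qed.

Lemma dirichlet_character_mod q chi n : dirichlet_character q chi ->
  chi n%:Z = chi (n %% q)%N%:Z.
Proof.
case=> _ _ chiD _; rewrite {1}(divn_eq n q).
elim: (n %/ q)%N => [|k IH]; first by rewrite mul0n add0n.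
by rewrite mulSn -addnA addnC PoszD chiD.
Qed.

(** A nonzero value is a root of unity: [n] is then coprime to [q], and Euler's theorem gives
    [n^totient q = 1] modulo [q]. *)
Lemma dirichlet_character_normc_le1 q chi n : dirichlet_character q chi ->
  cabs (chi n%:Z) <= 1.
Proof.
move=> hchi; case: (hchi) => q0 chiM _ chi0.
have [->|cn0] := eqVneq (chi n%:Z) 0; first by rewrite normr0.
have cop : coprime n q by move: cn0; rewrite chi0 coprimezE.
have chiX k : chi (n ^ k)%N%:Z = chi n%:Z ^+ k.
  elim: k => [|k IH]; first by rewrite expn0 expr0 (dirichlet_character1 hchi).
  by rewrite expnS PoszM chiM IH exprS.
have normX k : cabs (chi n%:Z ^+ k) = cabs (chi n%:Z) ^+ k.
  by elim: k => [|k IH]; rewrite ?normr1// !exprS normc_ReM IH.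
have : cabs (chi n%:Z) ^+ totient q = 1.
  rewrite -normX -chiX (dirichlet_character_mod _ hchi) (Euler_exp_totient cop).
  by rewrite -(dirichlet_character_mod _ hchi) (dirichlet_character1 hchi) normr1.
by move/eqP; rewrite pexpr_eq1 ?totient_gt0 ?normc_Re_ge0// => /eqP ->.
Qed.

Lemma nat_cpow_real n d : (0 < n)%N ->
  nat_cpow n (- (1 + d%:C)) = (n%:R `^ (- (1 + d)))%:C :> R[i].
Proof.
move=> n0; rewrite /nat_cpow /= addr0 oppr0 mul0r cos0 sin0 mulr1.
by rewrite powR_nat_gt0E ?ltr0n.
Qed.

Definition dirichlet_term chi d n : R[i] := chi n%:Z * (n%:R `^ (- (1 + d)))%:C.

Lemma dirichlet_term_cmultiplicative q chi d : dirichlet_character q chi ->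
  cmultiplicative (dirichlet_term chi d).
Proof.
move=> hchi; have chi1 := dirichlet_character1 hchi; case: hchi => _ chiM _ _.
split; first by rewrite /dirichlet_term chi1 powR1 mulr1.
move=> m n m0 n0.
by rewrite /dirichlet_term PoszM chiM natrM powRM ?ler0n// rmorphM mulrACA.
Qed.

Lemma dirichlet_term_le q chi d n : dirichlet_character q chi ->
  cabs (dirichlet_term chi d n) <= n%:R `^ (- (1 + d)).
Proof.
move=> hchi; rewrite normc_ReM normc_real (ger0_norm (powR_ge0 _ _)).
by rewrite ler_piMl ?powR_ge0// (dirichlet_character_normc_le1 _ hchi).
Qed.

(** [dirichlet_L] is a [lim], which is informative only once a limit exists; convergence comes first
    and uniqueness of limits identifies the value. *)
Lemma cvg_dirichlet_L q chi d : 0 < d -> dirichlet_character q chi ->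
  (rough_sum (dirichlet_term chi d) 0 : nat -> R[i]^o) @ \oo -->
    (dirichlet_L (1 + d%:C) chi : R[i]^o).
Proof.
move=> d0 hchi.
have [l hl] := is_cvg_rough_sum0 d0 (fun n _ => dirichlet_term_le d n hchi).
suff -> : dirichlet_L (1 + d%:C) chi = l by [].
rewrite /dirichlet_L.
rewrite (_ : (fun _ => _) = (rough_sum (dirichlet_term chi d) 0 : nat -> R[i]^o)).
  exact: (@norm_cvg_lim _ R[i]^o _ _ _ hl).
apply/funext => N; rewrite /rough_sum big_nat_cond [RHS]big_nat_cond.
by apply: eq_bigr => n /andP[/andP[n1 _] _]; rewrite nat_cpow_real.
Qed.

(** The trivial character gives zeta. Once [(N+1)^-d <= 1/2], the partial sums are at least
    [(1 - 1/2) / d]; the upper bound holds for all of them. *)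
Lemma zeta_bounds d : 0 < d ->
  1 / (2 * d) <= cabs (dirichlet_L (1 + d%:C) (@trivial_character R)) <= 1 + 1 / d.
Proof.
move=> d0; have zl := cvg_dirichlet_L d0 (@trivial_characterP R).
pose lo := 1 / (2 * d); pose hi := 1 + 1 / d.
have lo0 : 0 < lo by rewrite divr_gt0// mulr_gt0.
(* The interval from [lo] to [hi] becomes a disc with centre [c] and radius [r], the form in which
   bounds pass to complex limits. *)
pose c := (lo + hi) / 2; pose r := (hi - lo) / 2.
have [|K hK] := @powR_nat_small R d (1 / 2) d0; first by rewrite divr_gt0.
have : cabs (dirichlet_L (1 + d%:C) (@trivial_character R) - c%:C) <= r.
  apply: (cvgc_norm_le zl); exists K => // N KN.
  have -> : rough_sum (dirichlet_term (@trivial_character R) d) 0 N =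
     (\sum_(1 <= n < N.+1) (n%:R : R) `^ (- (1 + d)))%:C.
    by rewrite /rough_sum rmorph_sum /=; apply: eq_bigr => n _; rewrite /dirichlet_term mul1r.
  rewrite normc_realB; have h2 : _ <= hi := sum_powR_le N d0.
  have [_ k2] := hK N.+1 (leqW KN).
  have h1 : lo <= \sum_(1 <= n < N.+1) (n%:R : R) `^ (- (1 + d)).
    rewrite /lo mul1r invfM mulrC ler_pdivrMl//.
    by apply: le_trans (sum_powR_ge N (ltW d0)); lra.
  by rewrite ler_norml; apply/andP; split; rewrite /c /r; lra.
have dV0 : 0 < 1 / d by rewrite divr_gt0.
have c0 : 0 <= c by rewrite /c /hi; lra.
set Z := dirichlet_L _ _ => Zc.
have := ler_normD (Z - c%:C) c%:C; rewrite subrK [`|Z|]normcE_Re [`|Z - _|]normcE_Re.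
rewrite [`|c%:C|]normcE_Re -rmorphD lecR normc_real (ger0_norm c0) => h1.
have := ler_distD Z c%:C 0; rewrite !subr0 [`|_ - Z|]distrC.
rewrite [`|Z|]normcE_Re [`|Z - _|]normcE_Re [`|c%:C|]normcE_Re -rmorphD lecR.
rewrite normc_real (ger0_norm c0) => h2.
by move: Zc h1 h2; rewrite /r /c => Zc h1 h2; apply/andP; split; rewrite -?/lo -?/hi; lra.
Qed.

Lemma ln2_ge : 1 / 2 <= ln (2 : R).
Proof.
have := @le_ln_sub R 2 1 (ltr0Sn _ 1) ltr01; rewrite ln1; lra.
Qed.

(** Since [ln y >= 1/2], the upper bound [1 + ln y] is at most [3 ln y]. Thus zeta over [ln y] lies
    between 1/2 and 3, and [ln t <= t - 1] applies to this ratio and its inverse. *)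
Lemma ln_zeta_bound y : 2 <= y ->
  `|ln (cabs (dirichlet_L (1 + (1 / ln y)%:C) (@trivial_character R))) - ln (ln y)| <= 2.
Proof.
move=> y2; have ly : 1 / 2 <= ln y.
  by apply: le_trans ln2_ge _; rewrite ler_ln ?posrE//; lra.
have ly0 : 0 < ln y by lra.
have d0 : 0 < 1 / ln y by rewrite divr_gt0.
have /andP[] := zeta_bounds d0; set z := cabs _.
have -> : 1 / (2 * (1 / ln y)) = ln y / 2 by field; rewrite gt_eqF.
have -> : 1 / (1 / ln y) = ln y by field; rewrite gt_eqF.
move=> z1 z2; have z0 : 0 < z by lra.
have := le_ln_sub ly0 z0; have := le_ln_sub z0 ly0.
have : z / ln y <= 3 by rewrite ler_pdivrMr//; lra.
have : ln y / z <= 2 by rewrite ler_pdivrMr//; lra.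
by rewrite ler_norml => h1 h2 h3 h4; apply/andP; split; lra.
Qed.

(** The weights [1 - Re chi(p)] lie between 0 and 2. The difference is [A - B] with [0 <= A <= 4]
    from primes up to [y] and [0 <= B <= 8] from larger ones, so the errors do not add. *)
Lemma char_dist_truncation q chi y k : dirichlet_character q chi -> 2 <= y ->
  (Num.truncn y < k)%N ->
  `|char_dist chi (@trivial_character R) y ^+ 2 -
    \sum_(0 <= p < k | prime p)
      (1 - complex.Re (chi p%:Z)) * p%:R `^ (- (1 + 1 / ln y))| <= 8.
Proof.
move=> hchi y2 yk; have d0 : 0 <= 1 / ln y.
  by rewrite divr_ge0// ln_ge0//; lra.
set T := (Num.truncn y).+1; pose w p := 1 - complex.Re (chi p%:Z).
pose f p := (p%:R : R) `^ (- (1 + 1 / ln y)).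
have f0 p : 0 <= f p by exact: powR_ge0.
have fV p : prime p -> 0 <= p%:R^-1 - f p.
  by move=> /prime_gt0 p0; rewrite subr_ge0 powRN1D_le_inv.
have w02 p : 0 <= w p /\ w p <= 2.
  have := le_trans (le_normc_Re _) (dirichlet_character_normc_le1 p hchi).
  by rewrite ler_norml /w => /andP[? ?]; split; lra.
have -> : char_dist chi (@trivial_character R) y ^+ 2 = \sum_(0 <= p < T | prime p) w p / p%:R.
  have E p : (1 - complex.Re (chi p%:Z * ((@trivial_character R) p%:Z)^*)) / p%:R = w p / p%:R.
    by rewrite /trivial_character rmorph1 mulr1.
  rewrite /char_dist (eq_bigr _ (fun p _ => E p)) sqr_sqrtr// sumr_ge0// => p _.
  by rewrite divr_ge0//; case: (w02 p).
rewrite [X in _ - X](big_cat_nat (n := T))//= opprD addrA -sumrB.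
set A := \sum_(_ <= _ < _ | _) _; set B := \sum_(_ <= _ < _ | _) _.
have A0 : 0 <= A.
  apply: sumr_ge0 => p pp; rewrite -mulrBr mulr_ge0 ?fV//.
  by case: (w02 p).
have A4 : A <= 2 * 2.
  apply: le_trans (ler_pM _ _ (lexx 2) (sum_prime_small_le y2)) => //.
    rewrite mulr_sumr; apply: ler_sum => p pp; rewrite -mulrBr ler_wpM2r ?fV//.
    by case: (w02 p).
  exact: sumr_ge0.
have B0 : 0 <= B by apply: sumr_ge0 => p _; rewrite mulr_ge0//; case: (w02 p).
have B8 : B <= 2 * 4.
  apply: le_trans (ler_pM _ _ (lexx 2) (sum_prime_large_le k y2)) => //.
    by rewrite mulr_sumr; apply: ler_sum => p pp; rewrite ler_wpM2r//; case: (w02 p).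
  exact: sumr_ge0.
by rewrite ler_norml; apply/andP; split; lra.
Qed.

End Characters.

Theorem lemma3 (R : realType) :
  exists C : R, 0 < C /\
    forall (q : nat) (chi : int -> R[i]) (y : R),
      dirichlet_character q chi -> 2 <= y ->
      let s_y : R[i] := 1 + (1 / ln y)%:C in
      `| char_dist chi (@trivial_character R) y ^+ 2
         - ln (complex.Re `| (ln y)%:C / dirichlet_L s_y chi |) | <= C.
Proof.
(* [38 = 14 + 14 + 2 + 8]: the Euler products of [chi] and of zeta, the size of zeta, and the
   truncation at [y]. *)
exists 38; split=> [|q chi y hchi y2]; first by rewrite ltr0n.
(* The [let] sits under [is_true], so it cannot be introduced. *)
cbv zeta.
have ly0 : 0 < ln y by rewrite ln_gt0//; lra.
have d0 : 0 < 1 / ln y by rewrite divr_gt0.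
have Euler r psi (hpsi : dirichlet_character r psi) :=
  ln_normc_Euler_product d0 (dirichlet_term_cmultiplicative (1 / ln y) hpsi)
    (fun n _ => dirichlet_term_le (1 / ln y) n hpsi) (cvg_dirichlet_L d0 hpsi).
(* [L0] says that the L-value is nonzero, which lets the logarithm of the quotient split. *)
have [L0 [K1 hK1]] := Euler _ _ hchi.
have [_ [K2 hK2]] := Euler _ _ (@trivial_characterP R).
(* One cutoff beyond both Euler thresholds and beyond [y], so that all the prime sums share a range
   and cancel. *)
pose k := maxn (maxn K1 K2) (Num.truncn y).+1.
have := hK1 k; rewrite !leq_max leqnn => /(_ isT).
have := hK2 k; rewrite !leq_max leqnn orbT => /(_ isT).
have yk : (Num.truncn y < k)%N by rewrite !leq_max leqnn orbT.
have := char_dist_truncation hchi y2 yk; have := ln_zeta_bound y2.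
rewrite normc_ReM normc_ReV normc_real (gtr0_norm ly0) ln_div ?posrE//.
have -> : \sum_(0 <= p < k | prime p)
      (1 - complex.Re (chi p%:Z)) * p%:R `^ (- (1 + 1 / ln y)) =
    \sum_(0 <= p < k | prime p) complex.Re (dirichlet_term (@trivial_character R) (1 / ln y) p)
  - \sum_(0 <= p < k | prime p) complex.Re (dirichlet_term chi (1 / ln y) p).
  rewrite -sumrB; apply: eq_bigr => p _; rewrite /dirichlet_term /trivial_character.
  by rewrite mul1r; case: (chi _) => u v /=; ring.
rewrite !ler_norml => /andP[? ?] /andP[? ?] /andP[? ?] /andP[? ?].
by apply/andP; split; lra.
Qed.
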